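(* Let $a_2(n)$ denote the number of $2$-core partitions of $n$. For all $\alpha\ge1$, $\beta\ge0$, $n\ge0$ and $i\in\{1,2\}$, $$a_2\left(3^{2\alpha}n+3^{2\alpha-1}i+\frac{3^{2\alpha}-1}{8}\right)\equiv0\pmod2$$ and $$a_2\left(\frac{3^{2\beta}-1}{8}\right)\equiv1\pmod2.$$
   Context: A partition is a $t$-core partition if none of its hook lengths is divisible by $t$; $a_t(n)$ is the number of $t$-core partitions of $n$. Its generating function (Garvan–Kim–Stanton) is $\sum_{n\ge0}a_t(n)q^n=\prod_{n\ge1}\frac{(1-q^{tn})^t}{1-q^n}$. *)

(* Defs.v *)
From mathcomp Require Import all_boot.

Set Implicit Arguments.
Unset Strict Implicit.
Unset Printing Implicit Defensive.

Definition is_partition (n : nat) (la : seq nat) : bool :=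
  [&& sorted geq la, 0 \notin la & sumn la == n].

(* Rows and columns of the Young diagram are numbered from 0, so (i, j) is a
   cell of la when j < nth 0 la i; the three summands are the arm, the leg and
   the cell itself. *)
Definition hook_length (la : seq nat) (i j : nat) : nat :=
  (nth 0 la i - j.+1) + count (fun p => j < p) (drop i.+1 la) + 1.

Definition is_core (t : nat) (la : seq nat) : bool :=
  [forall i : 'I_(size la), forall j : 'I_(nth 0 la i),
     ~~ (t %| hook_length la i j)].

(* A partition of n has at most n parts, each at most n (is_partition_bseq),
   hence partitions of n are counted inside the finite type of sequences of
   length at most n over {0, ..., n}. *)
Definition num_cores (t n : nat) : nat :=
  #|[set la : {bseq n of 'I_n.+1} |
       is_partition n (map val la) & is_core t (map val la)]|.

Lemma is_partition_bseq (n : nat) (la : seq nat) :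
  is_partition n la -> exists mu : {bseq n of 'I_n.+1}, map val mu = la.
Proof.
case/and3P=> _ la_pos /eqP sum_la.
have size_la : size la <= n.
  rewrite -sum_la; elim: la la_pos {sum_la} => //= p la IHla.
  rewrite inE negb_or eq_sym -lt0n => /andP[p_gt0 /IHla le_la].
  by rewrite -add1n leq_add.
have le_la p : p \in la -> p < n.+1.
  rewrite ltnS -sum_la; elim: la {la_pos sum_la size_la} => //= q la IHla.
  rewrite inE => /predU1P[->|/IHla le_p]; first exact: leq_addr.
  exact: leq_trans le_p (leq_addl _ _).
have sz : size (map (@inord n) la) <= n by rewrite size_map.
exists (Bseq sz) => /=; rewrite -map_comp -[RHS]map_id.
by apply/eq_in_map => p /le_la lt_p /=; rewrite inordK.
Qed.

(* The division by 8 in the statement is exact. *)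
Lemma dvdn8_expn3B1 (k : nat) : 8 %| 3 ^ (2 * k) - 1.
Proof. by rewrite -eqn_mod_dvd ?expn_gt0 // expnM -modnXm exp1n. Qed.

(* Main.v *)
Require Import Defs.
From mathcomp Require Import all_boot.
From mathcomp Require Import zify.

(** The 2-cores are exactly the staircases (k, k - 1, ..., 1), so a_2(n) is 1
    when n = k (k + 1) / 2 for some k, that is when 8 n + 1 = (2 k + 1)^2, and 0
    otherwise. In the first congruence 8 n + 1 has odd 3-adic valuation, hence
    is not a square; in the second one it is (3 ^ beta)^2. *)

Definition staircase (k : nat) : seq nat := rev (iota 1 k).

Lemma staircaseS (k : nat) : staircase k.+1 = k.+1 :: staircase k.
Proof. by rewrite /staircase -{1}[k.+1]addn1 iotaD rev_cat /= add1n. Qed.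

Lemma sumn_staircase (k : nat) : sumn (staircase k) = 'C(k.+1, 2).
Proof.
by elim: k => // k IHk; rewrite staircaseS /= IHk [in RHS]binS bin1 addnC.
Qed.

Lemma count_staircase (k j : nat) :
  count (fun p => j < p) (staircase k) = k - j.
Proof. by elim: k => // k IHk; rewrite staircaseS /= IHk; lia. Qed.

Lemma staircase_partition (k : nat) :
  is_partition 'C(k.+1, 2) (staircase k).
Proof.
rewrite /is_partition sumn_staircase eqxx andbT; apply/andP; split.
  by rewrite rev_sorted; apply/sub_sorted/iota_sorted.
by rewrite mem_rev mem_iota.
Qed.

Lemma is_coreP (t : nat) (la : seq nat) :
  reflect (forall i j, i < size la -> j < nth 0 la i ->
             ~~ (t %| hook_length la i j))
          (is_core t la).
Proof.
apply: (iffP forallP) => [core i j lt_i lt_j | core i].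
  by move/forallP: (core (Ordinal lt_i)) => /(_ (Ordinal lt_j)).
by apply/forallP => j; apply: core.
Qed.

(** A row added on top leaves the hooks of the rows below unchanged, so only the hooks of the new
    row remain to be tested. *)
Lemma is_core_cons (t p : nat) (la : seq nat) :
  reflect ((forall j, j < p ->
              ~~ (t %| p - j.+1 + count (fun q => j < q) la + 1))
           /\ is_core t la)
          (is_core t (p :: la)).
Proof.
apply: (iffP (is_coreP _ _)) => [core | [core0 /is_coreP core] [|i] j].
- split=> [j lt_j|].
    by have := core 0 j isT lt_j; rewrite /hook_length /= drop0.
  by apply/is_coreP => i; apply: (core i.+1).
- by rewrite /hook_length /= drop0 => _; apply: core0.
by move=> lt_i; apply: core.
Qed.

(** In the top row of [staircase k.+1], the cell in column [j] has arm and leg both equal to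
    [k - j], so its hook length is odd. *)
Lemma staircase_core (k : nat) : is_core 2 (staircase k).
Proof.
elim: k => [|k IHk]; first by apply/is_coreP.
rewrite staircaseS; apply/is_core_cons; split=> // j lt_j.
by rewrite count_staircase; lia.
Qed.

(* If p is a row on top of a staircase of height k, a hook of length 2 occurs
   in column k - 1 when p = k, and in column p - 2 when p > k + 1. *)
Lemma core2_staircase (la : seq nat) :
  sorted geq la -> 0 \notin la -> is_core 2 la -> la = staircase (size la).
Proof.
elim: la => // p la IHla; rewrite [sorted _ _]/= inE negb_or eq_sym.
move=> path_la /andP[p_neq0 la_pos] /is_core_cons[core_p core_la].
have {IHla core_la} def_la := IHla (path_sorted path_la) la_pos core_la.
move: (size la) def_la => k def_la; move: path_la core_p.
rewrite def_la [size _]/= size_rev size_iota staircaseS => path_la core_p.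
congr (_ :: _).
(* For [k > 0] the first row of [staircase k] is [k], and sortedness bounds it by [p]. *)
have le_kp : k <= p.
  by case: (k) path_la => // k'; rewrite staircaseS /= => /andP[].
have [eq_pk | neq_pk] := eqVneq p k.
  by have := core_p p.-1; rewrite count_staircase; lia.
have [lt_kp | ?] := ltnP k.+1 p; last by lia.
by have := core_p p.-2; rewrite count_staircase; lia.
Qed.

(** By Pascal's rule the left side grows by [8 * k.+1], the gap between consecutive odd squares. *)
Lemma odd_square_triangular (k : nat) : 8 * 'C(k.+1, 2) + 1 = k.*2.+1 ^ 2.
Proof. by elim: k => // k IHk; rewrite binS bin1; lia. Qed.

Lemma triangular_inj : injective (fun k => 'C(k.+1, 2)).
Proof.
move=> k l /= eq_bin; have := odd_square_triangular k.
rewrite eq_bin odd_square_triangular => /eqP.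
by rewrite eqn_exp2r // => /eqP; lia.
Qed.

Lemma core2_partitionE (n : nat) (la : seq nat) :
  is_partition n la -> is_core 2 la ->
  la = staircase (size la) /\ n = 'C((size la).+1, 2).
Proof.
case/and3P=> sorted_la la_pos /eqP <- core_la.
have def_la := core2_staircase _ sorted_la la_pos core_la.
by split; rewrite // {1}def_la sumn_staircase.
Qed.

(** The staircase of height [k] is the only candidate, since a triangular number determines its
    index. *)
Lemma num_cores2_triangular (k : nat) : num_cores 2 'C(k.+1, 2) = 1.
Proof.
have [mu def_mu] := is_partition_bseq (staircase_partition k).
apply/eqP/cards1P; exists mu; apply/setP=> la; rewrite !inE.
apply/andP/eqP => [[part_la core_la] | ->]; last first.
  by rewrite def_mu staircase_partition staircase_core.
have [def_la eq_bin] := core2_partitionE _ _ part_la core_la.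
apply/val_inj/(inj_map val_inj); rewrite def_mu def_la; congr staircase.
exact/triangular_inj/esym.
Qed.

Lemma num_cores2_eq0 (n : nat) :
  (forall m, 8 * n + 1 <> m ^ 2) -> num_cores 2 n = 0.
Proof.
move=> nsq; apply/eqP; rewrite cards_eq0; apply/eqP/setP=> la; rewrite !inE.
apply/negP=> /andP[part_la core_la].
have [_ def_n] := core2_partitionE _ _ part_la core_la.
apply: (nsq (size (map val la)).*2.+1).
by rewrite -odd_square_triangular -def_n.
Qed.

Lemma expn3_divn8K (k : nat) : 8 * ((3 ^ (2 * k) - 1) %/ 8) + 1 = 3 ^ (2 * k).
Proof. by rewrite mulnC divnK ?dvdn8_expn3B1 // subnK ?expn_gt0. Qed.

Theorem theorem4p5 (alpha beta n i : nat)
    (halpha : 1 <= alpha) (hi : i \in [:: 1; 2]) :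
  num_cores 2 (3 ^ (2 * alpha) * n + 3 ^ (2 * alpha - 1) * i
               + (3 ^ (2 * alpha) - 1) %/ 8) = 0 %[mod 2]
  /\ num_cores 2 ((3 ^ (2 * beta) - 1) %/ 8) = 1 %[mod 2].
Proof.
split.
  rewrite num_cores2_eq0 // => m.
  rewrite mulnDr -addnA expn3_divn8K.
  have ->: 3 ^ (2 * alpha) = 3 ^ (2 * alpha - 1) * 3.
    by rewrite -expnSr; congr expn; lia.
  (* Eight times the argument plus 1 is [3 ^ e * c], with [e] odd. *)
  set e := 2 * alpha - 1; set c := 3 * (8 * n + 1) + 8 * i.
  have ->: 8 * (3 ^ e * 3 * n + 3 ^ e * i) + 3 ^ e * 3 = 3 ^ e * c.
    by rewrite /c; nia.
  (* Modulo 3, [c] is [2 * i], which is nonzero for [i] equal to 1 or 2. *)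
  have ndvd3 : ~~ (3 %| c).
    by move: hi; rewrite /c !inE => /orP[] /eqP ->; lia.
  have c_gt0 : 0 < c by rewrite /c; lia.
  (* The 3-adic valuation is even for [m ^ 2] but equals the odd [e] on the other side. *)
  move/(congr1 (logn 3)); rewrite lognX lognM ?expn_gt0 //.
  have log_c : logn 3 c = 0.
    by rewrite lognE (negbTE ndvd3) !andbF.
  by rewrite pfactorK // log_c /e; lia.
(* The height [k] of the staircase is chosen so that [k.*2.+1 = 3 ^ beta], which is odd. *)
suff ->: (3 ^ (2 * beta) - 1) %/ 8 = 'C((3 ^ beta)./2.+1, 2).
  by rewrite num_cores2_triangular.
have odd3 : odd (3 ^ beta) by rewrite oddX orbT.
have half3 : (3 ^ beta)./2.*2.+1 = 3 ^ beta.
  by rewrite -[RHS]odd_double_half odd3.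
have := odd_square_triangular (3 ^ beta)./2.
by rewrite half3 -expnM [beta * 2]mulnC -expn3_divn8K; lia.
Qed.
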